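(* Let $L>0$ and let $f:\mathbb{R}^{d_x}\times\mathbb{R}^{d_y}\to\mathbb{R}$ be an $L$-smooth, convex-concave function with saddle point $z^*=(x^*,y^* )$. Let $T\ge1$ be an integer, $0<h<\frac{1}{3L}$, and $z_0=(x_0,y_0)\in\mathbb{R}^{d_x}\times\mathbb{R}^{d_y}$. Then the iterates $z_t=(x_t,y_t)$ of GDA started at $z_0$ and using the randomized slingshot stepsize schedule with parameter $h$ (defined in the context) satisfy $$\frac1T\sum_{t=0}^{T-1}\mathbb{E}\left[\|\nabla f(z_{2t})\|^2\right]\le\frac{2\|z_0-z^*\|^2}{h^2(1-3Lh)\,T},$$ where the expectation is over the randomness of the stepsize schedule. In particular, using stepsize parameter $h=\frac{c}{L}$ for any constant $c\in(0,\frac13)$ ensures $$\frac1T\sum_{t=0}^{T-1}\mathbb{E}\left[\|\nabla f(z_{2t})\|^2\right]\lesssim\frac{L^2\|z_0-z^*\|^2}{T},$$ where $\lesssim$ hides a constant depending only on $c$.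
   Context: $f$ is $L$-smooth if it is differentiable and $\nabla f$ is $L$-Lipschitz (in the Euclidean norm $\|\cdot\|$). $f$ is convex-concave if $f(\cdot,y)$ is convex for every $y$ and $f(x,\cdot)$ is concave for every $x$. A saddle point is a point $(x^*,y^* )$ with $f(x^*,y)\le f(x^*,y^* )\le f(x,y^* )$ for all $x,y$. GDA with stepsizes $\alpha_t,\beta_t\in\mathbb{R}$ is the iteration $x_{t+1}=x_t-\alpha_t\nabla_x f(x_t,y_t)$, $y_{t+1}=y_t+\beta_t\nabla_y f(x_t,y_t)$. Randomized slingshot stepsize schedule with parameter $h$: independently for each $t=0,\dots,T-1$, choose the stepsizes in iterations $2t$ and $2t+1$ as follows. With probability $1/2$, $$\alpha_{2t}=-\beta_{2t}=\beta_{2t+1}=h\ \text{ and }\ \alpha_{2t+1}=0,$$ and otherwise $$-\alpha_{2t}=\beta_{2t}=\alpha_{2t+1}=h\ \text{ and }\ \beta_{2t+1}=0.$$ *)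

(* Defs.v *)
From HB Require Import structures.
From mathcomp Require Import all_boot all_order all_algebra.
From mathcomp Require Import all_classical all_reals all_analysis.

Set Implicit Arguments.
Unset Strict Implicit.
Unset Printing Implicit Defensive.

Import Order.TTheory GRing.Theory Num.Theory.
Import numFieldNormedType.Exports.

Local Open Scope classical_set_scope.
Local Open Scope ring_scope.

(* The library norm `|z| on 'rV[R]_m * 'rV[R]_n is the sup norm. It is used only
   through [differentiable] and ['D_v f], which do not depend on the choice of a
   norm in finite dimension; all quantitative bounds use [enorm]. *)
Definition enorm (R : realType) (m n : nat) (z : 'rV[R]_m * 'rV[R]_n) : R :=
  Num.sqrt (\sum_i (z.1 0 i) ^+ 2 + \sum_j (z.2 0 j) ^+ 2).

Definition gradx (R : realType) (m n : nat) (f : 'rV[R]_m * 'rV[R]_n -> R)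
    (z : 'rV[R]_m * 'rV[R]_n) : 'rV[R]_m :=
  \row_i 'D_(delta_mx 0 i, 0) f z.

Definition grady (R : realType) (m n : nat) (f : 'rV[R]_m * 'rV[R]_n -> R)
    (z : 'rV[R]_m * 'rV[R]_n) : 'rV[R]_n :=
  \row_j 'D_(0, delta_mx 0 j) f z.

Definition grad (R : realType) (m n : nat) (f : 'rV[R]_m * 'rV[R]_n -> R)
    (z : 'rV[R]_m * 'rV[R]_n) : 'rV[R]_m * 'rV[R]_n :=
  (gradx f z, grady f z).

Definition Lsmooth (R : realType) (m n : nat) (L : R)
    (f : 'rV[R]_m * 'rV[R]_n -> R) : Prop :=
  (forall z, differentiable f z) /\
  (forall z z', enorm (grad f z - grad f z') <= L * enorm (z - z')).

Definition convex_concave (R : realType) (m n : nat)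
    (f : 'rV[R]_m * 'rV[R]_n -> R) : Prop :=
  (forall y, convex_function [set: 'rV[R]_m] (fun x => f (x, y))) /\
  (forall x, convex_function [set: 'rV[R]_n] (fun y => - f (x, y))).

Definition saddle_point (R : realType) (m n : nat)
    (f : 'rV[R]_m * 'rV[R]_n -> R) (zs : 'rV[R]_m * 'rV[R]_n) : Prop :=
  forall x y, f (zs.1, y) <= f zs /\ f zs <= f (x, zs.2).

Fixpoint gda (R : realType) (m n : nat) (f : 'rV[R]_m * 'rV[R]_n -> R)
    (alpha beta : nat -> R) (z0 : 'rV[R]_m * 'rV[R]_n) (t : nat) :
    'rV[R]_m * 'rV[R]_n :=
  if t is s.+1 then
    let z := gda f alpha beta z0 s in
    (z.1 - alpha s *: gradx f z, z.2 + beta s *: grady f z)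
  else z0.

(* [b t] is the outcome of the coin which fixes the stepsizes of iterations
   2t and 2t+1; [true] selects the first of the two alternatives:
             (alpha_2t, beta_2t)   (alpha_2t+1, beta_2t+1)
     true         (h, -h)                 (0, h)
     false        (-h, h)                 (h, 0)                             *)
Definition slingshot_alpha (R : realType) (h : R) (b : nat -> bool) (t : nat) : R :=
  if odd t then (if b t./2 then 0 else h) else (if b t./2 then h else - h).

Definition slingshot_beta (R : realType) (h : R) (b : nat -> bool) (t : nat) : R :=
  if odd t then (if b t./2 then h else 0) else (if b t./2 then - h else h).

(* Mutual independence of X 0, ..., X (T - 1). *)
Definition mutually_independent (R : realType) (d : measure_display)
    (Omega : measurableType d) (P : probability Omega R) (d' : measure_display)
    (E : measurableType d') (T : nat) (X : nat -> {RV P >-> E}) : Prop :=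
  forall (J : {set 'I_T}) (B : 'I_T -> set E),
    (forall i, measurable (B i)) ->
    P (\bigcap_(i in [set` J]) (X i @^-1` B i)) =
    (\prod_(i in J) P (X i @^-1` B i))%E.

Definition fair_coins (R : realType) (d : measure_display)
    (Omega : measurableType d) (P : probability Omega R) (T : nat)
    (coin : nat -> {RV P >-> bool}) : Prop :=
  (forall t, (t < T)%N -> P (coin t @^-1` [set true]) = (1 / 2)%:E) /\
  mutually_independent T coin.

Definition slingshot_gda (R : realType) (d : measure_display)
    (Omega : measurableType d) (P : probability Omega R) (m n : nat)
    (f : 'rV[R]_m * 'rV[R]_n -> R) (h : R) (coin : nat -> {RV P >-> bool})
    (z0 : 'rV[R]_m * 'rV[R]_n) (t : nat) (w : Omega) : 'rV[R]_m * 'rV[R]_n :=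
  let b := fun s => coin s w in
  gda f (slingshot_alpha h b) (slingshot_beta h b) z0 t.

(* Main.v *)
Require Import Defs.
From HB Require Import structures.
From mathcomp Require Import all_boot all_order all_algebra.
From mathcomp Require Import all_classical all_reals all_analysis.
From mathcomp Require Import measurable_realfun.
From mathcomp Require Import ring lra.
Import Order.TTheory GRing.Theory Num.Theory.
Import numFieldNormedType.Exports.
Local Open Scope classical_set_scope.
Local Open Scope ring_scope.

Set Implicit Arguments.
Unset Strict Implicit.
Unset Printing Implicit Defensive.

(** The proof is a Lyapunov argument for V z = |z - zs|^2.

Write g = (gx, gy) for the gradient at z = (x, y), and zp = z + h g,
zm = z - h g. The true coin moves z to zm and then corrects only y by
h gy(zm); the false coin moves z to zp and then corrects only x by -h gx(zp).
In the average of the two displacements the gradients taken at z cancel: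
the mean displacement is (h/2) (-gx(zp), gy(zm)), a descent-ascent step whose
gradients are taken at extrapolated points. What remains is to see that this
step has a sufficiently negative inner product with z - zs
([slingshot_step_decrease]).

- The tangent inequalities at zp and zm ([tangent_x], [tangent_y]), with
  f(xs, yp) <= f(zs) <= f(xm, ys), give
    - <gx(zp), x - xs> + <gy(zm), y - ys>
      <= (f(zm) + h <gy(zm), gy>) - (f(zp) - h <gx(zp), gx>).
- The two brackets are linear extrapolations, from zm to (xm, y) and from zp to
  (x, yp). By the [descent] lemma they differ from f(xm, y) and f(x, yp) by a
  quadratic error, and the same lemma at z compares these values with f(z): the
  right-hand side is at most -h |g|^2 + L h^2 |g|^2. Passing through these two
  corner points, rather than bounding f(zm) - f(zp) and the inner products
  separately, keeps the coefficient of L h small enough for the constant 3.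
- The squared displacements contribute h^2/2 (|g|^2 + |gx(zp) - gx|^2 +
  |gy(zm) - gy|^2) on average, where the two differences are at most L h |g|.

With u = L h the average of V decreases by at least h^2 |g|^2 (1/2 - u - u^2), and
u^2 <= u/3 <= u/2 bounds this below by h^2 |g|^2 (1 - 3 u)/2.

The T independent fair coins make every word of {true, false}^T equally likely
([tosses_uniform]), so an expectation is an average over words
([expectation_tosses]). Since toggling the letter t of a word is a bijection that
does not affect the first t rounds, the one-step estimate sums and telescopes over
words ([lyapunov_sum]), with no conditional expectation involved. *)

(** * Euclidean inner products *)

Section dot.
Context {R : realType}.

Definition dot n (u v : 'rV[R]_n) : R := \sum_i u 0 i * v 0 i.

Lemma dotC n (u v : 'rV[R]_n) : dot u v = dot v u.
Proof. by apply: eq_bigr => i _; rewrite mulrC. Qed.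

Lemma dotDl n (u v w : 'rV[R]_n) : dot (u + v) w = dot u w + dot v w.
Proof. by rewrite -big_split; apply: eq_bigr => i _; rewrite mxE mulrDl. Qed.

Lemma dotZl n (a : R) (u v : 'rV[R]_n) : dot (a *: u) v = a * dot u v.
Proof. by rewrite mulr_sumr; apply: eq_bigr => i _; rewrite mxE mulrA. Qed.

Lemma dotNl n (u v : 'rV[R]_n) : dot (- u) v = - dot u v.
Proof. by rewrite -scaleN1r dotZl mulN1r. Qed.

Lemma dotDr n (u v w : 'rV[R]_n) : dot w (u + v) = dot w u + dot w v.
Proof. by rewrite !(dotC w) dotDl. Qed.

Lemma dotZr n (a : R) (u v : 'rV[R]_n) : dot u (a *: v) = a * dot u v.
Proof. by rewrite !(dotC u) dotZl. Qed.

Lemma dotNr n (u v : 'rV[R]_n) : dot u (- v) = - dot u v.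
Proof. by rewrite !(dotC u) dotNl. Qed.

Lemma dot0r n (u : 'rV[R]_n) : dot u 0 = 0.
Proof. by rewrite -(scale0r 0) dotZr mul0r. Qed.

Definition dotE := (dotDl, dotDr, dotNl, dotNr, dotZl, dotZr, @dot0r).

Lemma dot_ge0 n (u : 'rV[R]_n) : 0 <= dot u u.
Proof. by apply: sumr_ge0 => i _; rewrite -expr2 sqr_ge0. Qed.

Context {m n : nat}.
Implicit Types z v w : 'rV[R]_m * 'rV[R]_n.

Definition pdot z w : R := dot z.1 w.1 + dot z.2 w.2.

Lemma pdot_ge0 z : 0 <= pdot z z.
Proof. by rewrite addr_ge0 ?dot_ge0. Qed.

Lemma enorm_sqr z : enorm z ^+ 2 = pdot z z.
Proof. by rewrite sqr_sqrtr; [|apply: pdot_ge0]. Qed.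

(** The form of the Cauchy-Schwarz inequality that Lipschitz bounds need: it
follows from the nonnegativity of |w + c v|^2 and |w - c v|^2, without square
roots. *)
Lemma pdot_bound (c : R) v w : 0 < c -> pdot w w <= c ^+ 2 * pdot v v ->
  `|pdot w v| <= c * pdot v v.
Proof.
move=> c0 wv; rewrite ler_norml; apply/andP; split; rewrite -(ler_pM2l c0).
  have := pdot_ge0 (w + c *: v); move: wv; rewrite /pdot/= !dotE.
  rewrite (dotC v.1 w.1) (dotC v.2 w.2); lra.
have := pdot_ge0 (w - c *: v); move: wv; rewrite /pdot/= !dotE.
rewrite (dotC v.1 w.1) (dotC v.2 w.2); lra.
Qed.

End dot.

(** * Smoothness and convexity inequalities *)

Lemma convex_segment (R : realType) (E : lmodType R) (g : E -> R) :
  convex_function [set: E] g ->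
  forall (x x' : E) (s : R), 0 <= s -> s <= 1 ->
    g (x + s *: (x' - x)) <= g x + s * (g x' - g x).
Proof.
move=> cg x x' s s0 s1.
have := cg (Itv01 s0 s1) x' x; rewrite !inE => /(_ I I).
have -> : conv (Itv01 s0 s1) (x' : convex_lmodType E) x = x + s *: (x' - x).
  rewrite /conv/= scalerBl scale1r scalerBr /=.
  by rewrite addrCA.
rewrite convRE /= /unstable.onem; lra.
Qed.

Section smooth.
Context {R : realType} {m n : nat}.
Variables (L : R) (f : 'rV[R]_m * 'rV[R]_n -> R).
Implicit Types z v w : 'rV[R]_m * 'rV[R]_n.

(** The gradient is defined by partial derivatives; differentiability makes the
directional derivative linear in the direction, hence determined by them. *)
Lemma derive_grad z v : differentiable f z -> 'D_v f z = pdot (grad f z) v.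
Proof.
move=> df; have dE w : 'D_w f z = 'd f z w by rewrite deriveE.
have vE : v = \sum_i v.1 0 i *: (delta_mx 0 i, 0) +
              \sum_j v.2 0 j *: (0, delta_mx 0 j).
  clear; case: v => a b /=; rewrite [a in LHS]row_sum_delta [b in LHS]row_sum_delta.
  rewrite -[LHS]/((_, _)) -[X in (X, _)]addr0 -[X in (_, X)]add0r.
  rewrite -[LHS]/((_, _) + (_, _)).
  congr (_ + _).
    rewrite (big_morph (fun u : 'rV[R]_m => (u, 0 : 'rV[R]_n))
        (id1 := 0) (op1 := +%R)) //.
      by apply: eq_bigr => i _; congr (_, _); rewrite scaler0.
    by move=> u w; rewrite -[RHS]/((_, _)) addr0.
  rewrite (big_morph (fun u : 'rV[R]_n => (0 : 'rV[R]_m, u))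
      (id1 := 0) (op1 := +%R)) //.
    by apply: eq_bigr => i _; congr (_, _); rewrite scaler0.
  by move=> u w; rewrite -[RHS]/((_, _)) addr0.
rewrite dE {1}vE linearD !linear_sum/=; congr (_ + _); apply: eq_bigr => i _.
  by rewrite linearZ -dE mxE; exact: mulrC.
by rewrite linearZ -dE mxE; exact: mulrC.
Qed.

Lemma line_derive z v (s : R) : differentiable f (z + s *: v) ->
  is_derive s 1 (fun r : R => f (z + r *: v)) (pdot (grad f (z + s *: v)) v).
Proof.
move=> df; rewrite -derive_grad//.
have /derivableP := @diff_derivable _ _ _ _ _ v df.
have E : (fun h : R => h^-1 *: ((f \o shift (z + s *: v)) (h *: v) - f (z + s *: v)))
  = (fun h : R => h^-1 *: (((fun r : R => f (z + r *: v)) \o shift s) (h *: 1)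
                           - f (z + s *: v))).
  apply/funext => h /=; congr (_ *: (f _ - _)).
  by rewrite [h *: 1]mulr1 scalerDl addrCA.
by case=> d1 d2; apply: DeriveDef; rewrite /derivable /derive -E.
Qed.

(** Mean value theorem for r |-> f (z + r v) - r <grad f z, v> - k r^2. The
quadratic term makes the sign of the right-hand side depend only on a Lipschitz
bound once k is - or + L/2 |v|^2; the plain mean value theorem would lose the
factor 1/2 of the [descent] lemma. *)
Lemma taylor1 z v (k : R) : (forall w, differentiable f w) ->
  exists2 s : R, 0 < s < 1 &
    f (z + v) - f z - pdot (grad f z) v - k =
    pdot (grad f (z + s *: v) - grad f z) v - 2 * s * k.
Proof.
move=> df.
pose p (r : R) := f (z + r *: v) - (r * pdot (grad f z) v + k * r ^+ 2).
pose dp (r : R) := pdot (grad f (z + r *: v)) v - (pdot (grad f z) v + k * (2 * r)).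
have pd (r : R) : is_derive r (1 : R) p (dp r).
  apply: is_deriveB; first exact: line_derive.
  apply: is_derive_eq.
  by rewrite /GRing.scale /=; ring.
have pc : {within `[0, 1], continuous p}.
  apply: continuous_subspaceT => r; apply: differentiable_continuous.
  by apply/derivable1_diffP; case: (pd r).
have [s] := MVT ltr01 (fun r _ => pd r) pc.
rewrite in_itv/= => s01; rewrite /p /dp scale1r scale0r addr0 => E.
exists s => //; rewrite /pdot dotDl dotDl dotNl dotNl -/(pdot _ _).
move: E; rewrite /pdot; lra.
Qed.

Hypotheses (L0 : 0 < L) (fL : Lsmooth L f).

Lemma grad_lipschitz z w :
  pdot (grad f z - grad f w) (grad f z - grad f w) <= L ^+ 2 * pdot (z - w) (z - w).
Proof.
rewrite -!enorm_sqr -exprMn lerXn2r ?nnegrE ?mulr_ge0 ?sqrtr_ge0 ?(ltW L0)//.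
exact: fL.2.
Qed.

Lemma descent z v :
  `|f (z + v) - f z - pdot (grad f z) v| <= L / 2 * pdot v v.
Proof.
have key (s : R) w : 0 < s -> `|pdot (grad f (z + s *: w) - grad f z) w|
                              <= s * L * pdot w w.
  move=> s0; set d := grad f _ - _.
  have dd : pdot d d <= (s * L) ^+ 2 * pdot w w.
    apply: le_trans (grad_lipschitz _ _) _.
    by rewrite addrAC subrr add0r /pdot/= !dotE; lra.
  have sL0 : 0 < s * L by rewrite mulr_gt0.
  exact: pdot_bound.
rewrite ler_norml; apply/andP; split.
  have [s /andP[s0 s1] E] := taylor1 z v (- (L / 2 * pdot v v)) fL.1.
  have := key s v s0; rewrite ler_norml => /andP[k1 _]; lra.
have [s /andP[s0 s1] E] := taylor1 z v (L / 2 * pdot v v) fL.1.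
by have := key s v s0; rewrite ler_norml => /andP[_ k1]; lra.
Qed.

(** The limit s -> 0 of the difference quotients along a chord, for a remainder of
order s^2. With the [descent] lemma as the source of this remainder, the tangent
inequalities of convex functions need no further differentiation. *)
Lemma le_chord_limit (a b K : R) : 0 <= K ->
  (forall s : R, 0 < s <= 1 -> s * a <= s * b + s ^+ 2 * K) -> a <= b.
Proof.
move=> K0 ab; apply/ler_addgt0Pr => e e0.
(* Any s <= e / (K + 1) will do: K + 1 rather than K allows K = 0. *)
have K1 : 0 < K + 1 by lra.
pose s := Num.min 1 (e / (K + 1)).
have s0 : 0 < s by rewrite lt_min ltr01 divr_gt0.
have se : s * K <= e.
  apply: le_trans (_ : e / (K + 1) * K <= _).
    by rewrite ler_wpM2r// ge_min lexx orbT.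
  by rewrite mulrAC ler_pdivrMr// ler_pM2l//; lra.
have := ab s; rewrite s0 ge_min lexx => /(_ isT) h1.
by rewrite -(ler_pM2l s0); nra.
Qed.

Lemma descent_line z v (s : R) :
  `|f (z + s *: v) - f z - s * pdot (grad f z) v|
    <= s ^+ 2 * (L / 2 * pdot v v).
Proof.
have := descent z (s *: v).
have -> : pdot (grad f z) (s *: v) = s * pdot (grad f z) v.
  by rewrite /pdot/= !dotE mulrDr.
by have -> : L / 2 * pdot (s *: v) (s *: v) = s ^+ 2 * (L / 2 * pdot v v)
  by rewrite /pdot/= !dotE; ring.
Qed.

Let K_ge0 v : 0 <= L / 2 * pdot v v.
Proof. by rewrite mulr_ge0 ?pdot_ge0 ?divr_ge0 ?(ltW L0). Qed.

Hypothesis fcc : convex_concave f.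

Lemma tangent_x x x' y :
  f (x, y) + dot (gradx f (x, y)) (x' - x) <= f (x', y).
Proof.
rewrite addrC -lerBrDr; pose v : 'rV[R]_m * 'rV[R]_n := (x' - x, 0).
apply: (le_chord_limit (K_ge0 v)) => s /andP[s0 s1].
have := descent_line (x, y) v s; rewrite ler_norml => /andP[+ _].
have -> : pdot (grad f (x, y)) v = dot (gradx f (x, y)) (x' - x).
  by rewrite /pdot/= dot0r addr0.
have -> : (x, y) + s *: v = (x + s *: (x' - x), y).
  by rewrite -[LHS]/((_, y + s *: 0)) scaler0 addr0.
have := convex_segment (fcc.1 y) x x' (ltW s0) s1; lra.
Qed.

Lemma tangent_y x y y' :
  f (x, y') <= f (x, y) + dot (grady f (x, y)) (y' - y).
Proof.
rewrite addrC -lerBlDr; pose v : 'rV[R]_m * 'rV[R]_n := (0, y' - y).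
apply: (le_chord_limit (K_ge0 v)) => s /andP[s0 s1].
have := descent_line (x, y) v s; rewrite ler_norml => /andP[_].
have -> : pdot (grad f (x, y)) v = dot (grady f (x, y)) (y' - y).
  by rewrite /pdot/= dot0r add0r.
have -> : (x, y) + s *: v = (x, y + s *: (y' - y)).
  by rewrite -[LHS]/((x + s *: 0, _)) scaler0 addr0.
have := convex_segment (fcc.2 x) y y' (ltW s0) s1; lra.
Qed.

End smooth.

(** * One round of the slingshot schedule *)

Definition gda_step (R : realType) (m n : nat) (f : 'rV[R]_m * 'rV[R]_n -> R)
    (a b : R) (z : 'rV[R]_m * 'rV[R]_n) : 'rV[R]_m * 'rV[R]_n :=
  (z.1 - a *: gradx f z, z.2 + b *: grady f z).

Definition slingshot_step (R : realType) (m n : nat)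
    (f : 'rV[R]_m * 'rV[R]_n -> R) (h : R) (c : bool)
    (z : 'rV[R]_m * 'rV[R]_n) : 'rV[R]_m * 'rV[R]_n :=
  if c then gda_step f 0 h (gda_step f h (- h) z)
  else gda_step f h 0 (gda_step f (- h) h z).

Section one_step.
Context {R : realType} {m n : nat}.
Variables (L : R) (f : 'rV[R]_m * 'rV[R]_n -> R) (zs : 'rV[R]_m * 'rV[R]_n).
Hypotheses (L0 : 0 < L) (fL : Lsmooth L f) (fcc : convex_concave f).
Hypothesis fzs : saddle_point f zs.

(** For a fixed coin the distance to the saddle point may well increase; only the
sum over both outcomes is controlled. In that sum the gradients at z cancel from
the displacement, and the gradients at the extrapolated points that remain are
those for which convexity and concavity produce the gain |grad f z|^2. *)
Lemma slingshot_step_decrease (h : R) (z : 'rV[R]_m * 'rV[R]_n) :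
  0 < h -> L * h <= 1 / 3 ->
  enorm (slingshot_step f h true z - zs) ^+ 2 +
  enorm (slingshot_step f h false z - zs) ^+ 2 +
  h ^+ 2 * (1 - 3 * L * h) * enorm (grad f z) ^+ 2 <= 2 * enorm (z - zs) ^+ 2.
Proof.
move=> h0 Lh.
rewrite !enorm_sqr /slingshot_step /gda_step /=.
case: z zs fzs => [x y] [xs ys] /= fs.
set gx := gradx f (x, y); set gy := grady f (x, y).
have gE : grad f (x, y) = (gx, gy) by [].
rewrite !scale0r !subr0 !addr0 !scaleNr !opprK.
set zm := (x - h *: gx, y - h *: gy); set zp := (x + h *: gx, y + h *: gy).
set gxp := gradx f zp; set gym := grady f zm.
pose u := x - xs; pose w := y - ys.
(* Tangents at the extrapolated points, compared through the saddle point. *)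
have F1 : f zp - dot gxp u - h * dot gxp gx <= f (xs, y + h *: gy).
  apply: le_trans (tangent_x L0 fL fcc (x + h *: gx) xs (y + h *: gy)).
  have -> : xs - (x + h *: gx) = - u - h *: gx by rewrite opprD addrA opprB.
  by rewrite -/zp -/gxp !dotE; lra.
have F2 : f (x - h *: gx, ys) <= f zm - dot gym w + h * dot gym gy.
  apply: le_trans (tangent_y L0 fL fcc (x - h *: gx) (y - h *: gy) ys) _.
  have -> : ys - (y - h *: gy) = - w + h *: gy.
    by rewrite opprD opprK addrA opprB.
  by rewrite -/zm -/gym !dotE; lra.
have F3 : f (xs, y + h *: gy) <= f (x - h *: gx, ys).
  by have [+ _] := fs xs (y + h *: gy); have [_ +] := fs (x - h *: gx) ys; lra.
(* Back from zp and zm to z through the corners (x, y + h gy) and (x - h gx, y),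
   changing one block of variables at a time. *)
have F4 : f (x, y + h *: gy) <= f zp - h * dot gxp gx + L / 2 * h ^+ 2 * dot gx gx.
  have := descent L0 fL zp (- (h *: gx), 0); rewrite ler_norml => /andP[_].
  have -> : zp + (- (h *: gx), 0) = (x, y + h *: gy).
    by rewrite -[LHS]/((_, _)) /= addrK addr0.
  by rewrite /pdot /= -/gxp !dotE; lra.
have F5 : f (x, y) + h * dot gy gy - L / 2 * h ^+ 2 * dot gy gy <= f (x, y + h *: gy).
  have := descent L0 fL (x, y) (0, h *: gy); rewrite ler_norml => /andP[+ _].
  have -> : (x, y) + (0, h *: gy) = (x, y + h *: gy).
    by rewrite -[LHS]/((_, _)) /= addr0.
  by rewrite /pdot /= -/gy !dotE; lra.
have F6 : f zm + h * dot gym gy - L / 2 * h ^+ 2 * dot gy gy <= f (x - h *: gx, y).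
  have := descent L0 fL zm (0, h *: gy); rewrite ler_norml => /andP[+ _].
  have -> : zm + (0, h *: gy) = (x - h *: gx, y).
    by rewrite -[LHS]/((_, _)) /= subrK addr0.
  by rewrite /pdot /= -/gym !dotE; lra.
have F7 : f (x - h *: gx, y) <= f (x, y) - h * dot gx gx + L / 2 * h ^+ 2 * dot gx gx.
  have := descent L0 fL (x, y) (- (h *: gx), 0); rewrite ler_norml => /andP[_].
  have -> : (x, y) + (- (h *: gx), 0) = (x - h *: gx, y).
    by rewrite -[LHS]/((_, _)) /= addr0.
  by rewrite /pdot /= -/gx !dotE; lra.
pose N := dot gx gx + dot gy gy.
have N0 : 0 <= N by rewrite addr_ge0 ?dot_ge0.
(* These two gradient differences enter through the squared displacements. *)
have F8 : dot (gxp - gx) (gxp - gx) <= (L * h) ^+ 2 * N.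
  have := grad_lipschitz L0 fL zp (x, y).
  have -> : zp - (x, y) = (h *: gx, h *: gy).
    by rewrite -[LHS]/((_, _)) /=; congr (_, _); rewrite addrAC subrr add0r.
  rewrite /N /pdot /= -/gxp -/gx !(dotZl, dotZr).
  have := dot_ge0 (grady f zp - grady f (x, y)); lra.
have F9 : dot (gym - gy) (gym - gy) <= (L * h) ^+ 2 * N.
  have := grad_lipschitz L0 fL zm (x, y).
  have -> : zm - (x, y) = (- (h *: gx), - (h *: gy)).
    by rewrite -[LHS]/((_, _)) /=; congr (_, _); rewrite addrAC subrr add0r.
  rewrite /N /pdot /= -/gym -/gy !(dotZl, dotZr, dotNl, dotNr).
  have := dot_ge0 (gradx f zm - gradx f (x, y)); lra.
(* The step bound makes (L h)^2 at most half of L h, which is what is left of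
   the 3/2 L h of the claim after the error L h of the [descent] lemma. *)
have F10 : (L * h) ^+ 2 * N <= L * h / 3 * N.
  have Lh0 : 0 < L * h by rewrite mulr_gt0.
  by rewrite ler_wpM2r// expr2 ler_pM2l//; lra.
have G : - dot gxp u + dot gym w <= - h * N + L * h ^+ 2 * N by rewrite /N; lra.
have -> : (x - h *: gx, y - h *: gy + h *: gym) - (xs, ys) =
          (u - h *: gx, w + h *: (gym - gy)).
  rewrite -[LHS]/((_, _)) /= scalerBr; congr (_, _); first by rewrite addrAC.
  by rewrite addrAC -!addrA; congr (_ + _); rewrite addrCA; congr (_ + _); rewrite addrC.
have -> : (x + h *: gx - h *: gxp, y + h *: gy) - (xs, ys) =
          (u - h *: (gxp - gx), w + h *: gy).
  rewrite -[LHS]/((_, _)) /= scalerBr opprB; congr (_, _); last by rewrite addrAC.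
  by rewrite addrAC [X in X - _ = _]addrAC addrA.
rewrite -[(x, y) - _]/((u, w)) gE /pdot /=.
have Eu : dot gxp u = dot (gxp - gx) u + dot gx u by rewrite dotDl dotNl subrK.
have Ew : dot gym w = dot (gym - gy) w + dot gy w by rewrite dotDl dotNl subrK.
rewrite {}Eu {}Ew in G.
move: (gxp - gx) (gym - gy) F8 F9 G => a b F8 F9 G.
have hG : h * (- (dot a u + dot gx u) + (dot b w + dot gy w)) <=
          h * (- h * N + L * h ^+ 2 * N) by rewrite ler_pM2l.
have hab : h ^+ 2 * (dot a a + dot b b) <= h ^+ 2 * (2 * (L * h / 3 * N)).
  by rewrite ler_pM2l ?exprn_gt0//; lra.
have hN : 0 <= h ^+ 2 * (L * h * N).
  by rewrite !mulr_ge0 ?sqr_ge0 ?(ltW L0) ?(ltW h0).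
clearbody gx gy u w.
rewrite !dotE (dotC u gx) (dotC u a) (dotC w b) (dotC w gy).
rewrite /N in hG hab hN; lra.
Qed.

End one_step.

(** * Lyapunov functions of processes driven by coins *)

Fixpoint coin_run (S : Type) (step : bool -> S -> S) (s0 : S) (b : nat -> bool)
    (t : nat) : S :=
  if t is r.+1 then step (b r) (coin_run step s0 b r) else s0.

Lemma eq_coin_run (S : Type) (step : bool -> S -> S) s0 (b b' : nat -> bool) t :
  (forall r, (r < t)%N -> b r = b' r) ->
  coin_run step s0 b t = coin_run step s0 b' t.
Proof.
elim: t => //= t IH bb'; rewrite bb' ?ltnSn// IH// => r rt.
by rewrite bb'// ltnS ltnW.
Qed.

Lemma gda_coin_run (R : realType) m n (f : 'rV[R]_m * 'rV[R]_n -> R) h b z0 t :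
  gda f (slingshot_alpha h b) (slingshot_beta h b) z0 (2 * t) =
  coin_run (slingshot_step f h) z0 b t.
Proof.
elim: t => [//|t IH]; rewrite mul2n doubleS /= -mul2n IH.
rewrite /slingshot_alpha /slingshot_beta /= mul2n odd_double /= uphalf_double doubleK.
by rewrite /slingshot_step; case: (b t).
Qed.

(** Words are extended by [false] so that they can drive a process indexed by nat;
only letters below T matter in the first T rounds. *)
Definition coin_word T (c : {ffun 'I_T -> bool}) (t : nat) : bool :=
  oapp c false (insub t).

Lemma coin_wordE T (c : {ffun 'I_T -> bool}) (i : 'I_T) : coin_word c i = c i.
Proof. by rewrite /coin_word valK. Qed.

Section lyapunov.
Context {R : realType} {S : Type} (step : bool -> S -> S) (s0 : S) (V G : S -> R).
Variable T : nat.
Local Notation run c := (coin_run step s0 (coin_word c)).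

(** The law of total expectation for round t, in the form of a reindexing: toggling
letter t is an involution on words which leaves the state before round t
unchanged and swaps the two outcomes of the round. *)
Lemma sum_coin_step (t : nat) : (t < T)%N ->
  2 * \sum_(c : {ffun 'I_T -> bool}) V (run c t.+1) =
  \sum_(c : {ffun 'I_T -> bool})
    (V (step true (run c t)) + V (step false (run c t))).
Proof.
move=> tT; pose k := Ordinal tT.
pose flip (c : {ffun 'I_T -> bool}) := [ffun i => (i == k) (+) c i].
have flipK : involutive flip.
  by move=> c; apply/ffunP => i; rewrite !ffunE addbA addbb.
have run_flip c : run (flip c) t = run c t.
  apply: eq_coin_run => r rt; have rT := ltn_trans rt tT.
  rewrite -[r]/(val (Ordinal rT)) !coin_wordE ffunE.
  by rewrite -val_eqE /= (ltn_eqF rt).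
rewrite mulr_natl mulr2n {2}(reindex_inj (inv_inj flipK)) -big_split /=.
apply: eq_bigr => c _; rewrite run_flip -[t]/(val k) !coin_wordE ffunE eqxx.
by case: (c k) => //=; rewrite addrC.
Qed.

Hypothesis V_ge0 : forall s, 0 <= V s.
Hypothesis V_step : forall s, V (step true s) + V (step false s) + G s <= 2 * V s.

(** The 2^T words all start at s0, so that multiplying by 2^-T turns this
into the bound 2 V s0 for the sum of the expectations of G. *)
Lemma lyapunov_sum :
  \sum_(0 <= t < T) \sum_(c : {ffun 'I_T -> bool}) G (run c t) <=
  2 * (2 ^+ T * V s0).
Proof.
have tele t : (t <= T)%N ->
    2 * \sum_(c : {ffun 'I_T -> bool}) V (run c t) +
    \sum_(0 <= r < t) \sum_(c : {ffun 'I_T -> bool}) G (run c r) <=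
    2 * (2 ^+ T * V s0).
  elim: t => [_|t IH tT].
    rewrite big_nil addr0 /= sumr_const card_ffun card_bool card_ord.
    by rewrite -[X in 2 * X]mulr_natl natrX.
  apply: le_trans (IH (ltnW tT)).
  rewrite big_nat_recr//= sum_coin_step// mulr_sumr addrCA addrC lerD2r -big_split.
  by apply: ler_sum => c _; exact: V_step.
apply: le_trans (tele T (leqnn T)).
by rewrite lerDr mulr_ge0// sumr_ge0.
Qed.

End lyapunov.

(** * Expectations over independent fair coins *)

Section expectation.
Context {R : realType} {d : measure_display} {Omega : measurableType d}.
Context {P : probability Omega R} (coin : nat -> {RV P >-> bool}) (T : nat).
Hypothesis fair : fair_coins T coin.

Definition tosses (w : Omega) : {ffun 'I_T -> bool} := [ffun i : 'I_T => coin i w].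

Lemma tosses_preimage c :
  tosses @^-1` [set c] =
  \bigcap_(i in [set` [set: 'I_T]%SET]) (coin i @^-1` [set c i]).
Proof.
apply/seteqP; split => [w /= <- i _ /=|w /= wc]; first by rewrite ffunE.
by apply/ffunP => i; rewrite ffunE; apply: wc => /=; rewrite inE.
Qed.

Lemma measurable_tosses c : measurable (tosses @^-1` [set c]).
Proof.
rewrite tosses_preimage; apply: fin_bigcap_measurable => [|i _].
  exact: finite_finset.
exact: measurable_funPTI.
Qed.

Lemma tosses_uniform c : P (tosses @^-1` [set c]) = ((2 ^+ T)^-1)%:E.
Proof.
have half i : (i < T)%N -> forall b, P (coin i @^-1` [set b]) = (2^-1)%:E.
  move=> iT; case; first by rewrite fair.1// mul1r.
  have -> : coin i @^-1` [set false] = ~` (coin i @^-1` [set true]).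
    by apply/seteqP; split => w /=; case: (coin i w).
  rewrite probability_setC; last exact: measurable_funPTI.
  by rewrite fair.1// -EFinB; congr (_%:E); lra.
rewrite tosses_preimage.
rewrite (@fair.2 [set: 'I_T]%SET (fun i => [set c i])) //.
rewrite (eq_bigr (fun=> (2^-1)%:E)) => [|i _]; last exact: half.
rewrite prodEFin prodr_const cardsT card_ord exprVn//.
Qed.

(** A function of the tosses is a finite combination of indicators of the events
that the tosses spell a given word. *)
Lemma expectation_tosses (F : {ffun 'I_T -> bool} -> R) : (forall c, 0 <= F c) ->
  ('E_P[fun w => F (tosses w)] = ((2 ^+ T)^-1 * \sum_c F c)%R%:E)%E.
Proof.
move=> F0; rewrite unlock.
transitivity (\int[P]_w (\sum_c (F c)%:E * (\1_(tosses @^-1` [set c]) w)%:E))%E.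
  apply: eq_integral => w _; rewrite (bigD1 (tosses w)) //= big1 ?adde0.
    by rewrite indicE mem_set// mule1.
  move=> c; rewrite eq_sym => /eqP cw.
  by rewrite indicE memNset ?mule0.
rewrite ge0_integral_sum//.
- rewrite mulr_sumr -sumEFin; apply: eq_bigr => c _.
  rewrite ge0_integralZl_EFin//.
    rewrite integral_indic//; last exact: measurable_tosses.
    by rewrite setIT [X in (_ * X)%E](tosses_uniform c) -EFinM mulrC.
  by apply/measurable_EFinP; exact: measurable_indic (measurable_tosses c).
- move=> c; apply: measurable_funeM.
  by apply/measurable_EFinP; exact: measurable_indic (measurable_tosses c).
- by move=> c w _; rewrite mule_ge0// lee_fin.
Qed.

End expectation.

(** * Convergence rate *)

Lemma slingshot_gda_tosses (R : realType) d (Omega : measurableType d)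
    (P : probability Omega R) m n (f : 'rV[R]_m * 'rV[R]_n -> R) h
    (coin : nat -> {RV P >-> bool}) z0 T t w : (t < T)%N ->
  slingshot_gda f h coin z0 (2 * t) w =
  coin_run (slingshot_step f h) z0 (coin_word (tosses coin T w)) t.
Proof.
move=> tT; rewrite /slingshot_gda gda_coin_run; apply: eq_coin_run => r rt.
have rT := ltn_trans rt tT.
by rewrite -[r in RHS]/(val (Ordinal rT)) coin_wordE ffunE.
Qed.

Lemma slingshot_rate (R : realType) (dx dy : nat) (L : R)
    (f : 'rV[R]_dx * 'rV[R]_dy -> R) (zs z0 : 'rV[R]_dx * 'rV[R]_dy)
    (T : nat) (h : R) (d : measure_display) (Omega : measurableType d)
    (P : probability Omega R) (coin : nat -> {RV P >-> bool}) :
  0 < L -> Lsmooth L f -> convex_concave f -> saddle_point f zs ->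
  (1 <= T)%N -> 0 < h -> h < 1 / (3 * L) -> fair_coins T coin ->
  ((1 / T%:R)%:E *
     \sum_(0 <= t < T)
       'E_P[fun w => (enorm (grad f (slingshot_gda f h coin z0 (2 * t)%N w)) ^+ 2)%R]
   <= (2 * enorm (z0 - zs) ^+ 2 / (h ^+ 2 * (1 - 3 * L * h) * T%:R))%:E)%E.
Proof.
move=> L0 fL fcc fzs T0 h0 hL fair.
have T0' : (0 : R) < T%:R by rewrite ltr0n.
have L30 : 0 < 3 * L by rewrite mulr_gt0.
have Lh : 0 < 1 - 3 * L * h.
  by rewrite subr_gt0 mulrC -ltr_pdivlMr.
pose kappa := h ^+ 2 * (1 - 3 * L * h).
have kappa0 : 0 < kappa by rewrite mulr_gt0 ?exprn_gt0.
pose G z := enorm (grad f z) ^+ 2.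
pose run (c : {ffun 'I_T -> bool}) := coin_run (slingshot_step f h) z0 (coin_word c).
have ET t : (t < T)%N ->
    'E_P[fun w => (enorm (grad f (slingshot_gda f h coin z0 (2 * t)%N w)) ^+ 2)%R]%E =
    ((2 ^+ T)^-1 * \sum_c G (run c t))%:E.
  move=> tT; rewrite -(expectation_tosses fair (F := fun c => G (run c t)))//.
    by congr expectation; apply/funext => w; rewrite (slingshot_gda_tosses _ _ _ _ _ tT).
  by move=> c; rewrite sqr_ge0.
rewrite (eq_big_nat _ _ (F2 := fun t => ((2 ^+ T)^-1 * \sum_c G (run c t))%:E));
  last by move=> t tT; exact: ET.
rewrite sumEFin -EFinM lee_fin -mulr_sumr.
have step z : enorm (slingshot_step f h true z - zs) ^+ 2 +
    enorm (slingshot_step f h false z - zs) ^+ 2 + kappa * G z <=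
    2 * enorm (z - zs) ^+ 2.
  by apply: (@slingshot_step_decrease _ _ _ L) => //; lra.
have := lyapunov_sum z0 T (fun z => sqr_ge0 (enorm (z - zs))) step.
under eq_bigr do rewrite -mulr_sumr.
rewrite -mulr_sumr -/run; set X := \sum_(0 <= t < T) _ => HX.
rewrite -/kappa ler_pdivlMr ?mulr_gt0//.
have T2 : (0 : R) < 2 ^+ T by rewrite exprn_gt0.
have -> : 1 / T%:R * (2 ^- T * X) * (kappa * T%:R) = (kappa * X) / 2 ^+ T.
  by field; rewrite !gt_eqF.
by rewrite ler_pdivrMr//; lra.
Qed.

Theorem theorem4p4 (R : realType) :
  (forall (dx dy : nat) (L : R) (f : 'rV[R]_dx * 'rV[R]_dy -> R)
     (zs z0 : 'rV[R]_dx * 'rV[R]_dy) (T : nat) (h : R)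
     (d : measure_display) (Omega : measurableType d)
     (P : probability Omega R) (coin : nat -> {RV P >-> bool}),
     0 < L -> Lsmooth L f -> convex_concave f -> saddle_point f zs ->
     (1 <= T)%N -> 0 < h -> h < 1 / (3 * L) -> fair_coins T coin ->
     ((1 / T%:R)%:E *
        \sum_(0 <= t < T)
          'E_P[fun w => (enorm (grad f (slingshot_gda f h coin z0 (2 * t)%N w)) ^+ 2)%R]
      <= (2 * enorm (z0 - zs) ^+ 2 / (h ^+ 2 * (1 - 3 * L * h) * T%:R))%:E)%E)
  /\
  (forall c : R, 0 < c -> c < 1 / 3 ->
   exists C : R,
   forall (dx dy : nat) (L : R) (f : 'rV[R]_dx * 'rV[R]_dy -> R)
     (zs z0 : 'rV[R]_dx * 'rV[R]_dy) (T : nat)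
     (d : measure_display) (Omega : measurableType d)
     (P : probability Omega R) (coin : nat -> {RV P >-> bool}),
     0 < L -> Lsmooth L f -> convex_concave f -> saddle_point f zs ->
     (1 <= T)%N -> fair_coins T coin ->
     ((1 / T%:R)%:E *
        \sum_(0 <= t < T)
          'E_P[fun w => (enorm (grad f (slingshot_gda f (c / L) coin z0 (2 * t)%N w)) ^+ 2)%R]
      <= (C * (L ^+ 2 * enorm (z0 - zs) ^+ 2 / T%:R))%:E)%E).
Proof.
split=> [*|c c0 c3]; first exact: slingshot_rate.
exists (2 / (c ^+ 2 * (1 - 3 * c))).
move=> dx dy L f zs z0 T d Omega P coin L0 fL fcc fzs T0 fair.
have hL : c / L < 1 / (3 * L).
  by rewrite [1 / _](_ : _ = 1 / 3 / L) ?ltr_pM2r ?invr_gt0//; field; rewrite gt_eqF.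
apply: le_trans (slingshot_rate z0 L0 fL fcc fzs T0 _ hL fair) _.
  by rewrite divr_gt0.
rewrite lee_fin le_eqVlt; apply/orP; left; apply/eqP; field.
have c1 : 0 < 1 - 3 * c by lra.
by rewrite !gt_eqF ?ltr0n.
Qed.
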